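(* Let $n\ge 2$. Given a configuration of $n+2$ oriented spherical caps $C_1,\ldots,C_{n+2}$ in $S^n$ that is a spherical Descartes configuration, the $(n+2)\times(n+2)$ matrix $\mathbf{W}_+$ whose $j$-th row is the vector $\mathbf{w}_+(C_j)$ of spherical curvature-center coordinates of $C_j$ satisfies $$\mathbf{W}_+^T\mathbf{Q}_n\mathbf{W}_+ = \begin{bmatrix}-2&0&0\\0&2&0\\0&0&2I_n\end{bmatrix} = \mathrm{diag}(-2,2,2,\ldots,2).$$ Conversely, any real $(n+2)\times(n+2)$ matrix $\mathbf{W}_+$ that satisfies this equation is the spherical curvature-center coordinate matrix of some spherical Descartes configuration.
   Context: $\mathbf{Q}_n := I_{n+2} - \frac1n \mathbf{1}_{n+2}\mathbf{1}_{n+2}^T$, where $\mathbf{1}_{n+2}$ is the column vector of $n+2$ ones. $S^n=\{(y_0,\ldots,y_n)\in\mathbb{R}^{n+1}: y_0^2+\cdots+y_n^2=1\}$, with distance between two points equal to the angle in $[0,\pi]$ between the radii joining them to the origin. A sphere in $S^n$ is the locus of points at a fixed distance $\alpha$, $0<\alpha<\pi$, from a point of $S^n$ called its center; $\alpha$ is its angular radius. A sphere has two possible choices of (center, angular radius), namely $(\mathbf{y},\alpha)$ and $(-\mathbf{y},\pi-\alpha)$; choosing one orients the sphere. An oriented sphere is also called a spherical cap; its interior is the set of points of $S^n$ at distance less than $\alpha$ from the chosen center. The two caps determined by the same sphere are called complementary. Caps are tangent if their bounding spheres meet in exactly one point. A spherical Descartes configuration consists of $n+2$ mutually tangent spherical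 caps on $S^n$ such that either (i) the interiors of all the caps are mutually disjoint, or (ii) the interiors of all the complementary caps are mutually disjoint. For a spherical cap $C$ with center $\mathbf{y}=(y_0,y_1,\ldots,y_n)$ and angular radius $\alpha$, its spherical curvature-center coordinates are the row vector of length $n+2$ $$\mathbf{w}_+(C)=\Big(\cot\alpha,\frac{y_0}{\sin\alpha},\frac{y_1}{\sin\alpha},\ldots,\frac{y_n}{\sin\alpha}\Big).$$ The spherical curvature-center coordinate matrix of caps $C_1,\ldots,C_{n+2}$ is the matrix whose $j$-th row is $\mathbf{w}_+(C_j)$. *)

(* Defs.v *)
From mathcomp Require Import all_boot all_order all_algebra.
From mathcomp Require Import classical_sets reals trigo.
Set Implicit Arguments.
Unset Strict Implicit.
Unset Printing Implicit Defensive.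
Import Order.TTheory GRing.Theory Num.Theory.
Local Open Scope classical_set_scope.
Local Open Scope ring_scope.

Definition dotp (R : realType) (m : nat) (x y : 'rV[R]_m) : R :=
  \sum_(i < m) x 0 i * y 0 i.

(* S^n sits in R^(n+1). *)
Definition usphere (R : realType) (n : nat) : set 'rV[R]_n.+1 :=
  [set y | \sum_(i < n.+1) y 0 i ^+ 2 = 1].

(* Only meaningful for points of the unit sphere, whose dot product lies in
   [-1, 1]; acos then takes its values in [0, pi]. *)
Definition angdist (R : realType) (n : nat) (x y : 'rV[R]_n.+1) : R :=
  acos (dotp x y).

(* An oriented sphere, i.e. a choice of center and angular radius. *)
Record cap (R : realType) (n : nat) := Cap {
  center : 'rV[R]_n.+1;
  angrad : R;
  center_usphere : usphere center;
  angrad_bounds : 0 < angrad < pi }.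

Definition boundary (R : realType) (n : nat) (C : cap R n) :
    set 'rV[R]_n.+1 :=
  [set x | usphere x /\ angdist x (center C) = angrad C].

Definition cap_interior (R : realType) (n : nat) (C : cap R n) :
    set 'rV[R]_n.+1 :=
  [set x | usphere x /\ angdist x (center C) < angrad C].

Lemma oppr_usphere (R : realType) (n : nat) (y : 'rV[R]_n.+1) :
  usphere y -> usphere (- y).
Proof.
by rewrite /usphere /= => <-; apply: eq_bigr => i _; rewrite mxE sqrrN.
Qed.

Lemma supp_angle_bounds (R : realType) (a : R) :
  0 < a < pi -> 0 < pi - a < pi.
Proof. by case/andP=> a0 api; rewrite subr_gt0 api ltrBlDr ltrDl a0. Qed.

Definition complementary (R : realType) (n : nat) (C : cap R n) : cap R n :=
  Cap (oppr_usphere (center_usphere C)) (supp_angle_bounds (angrad_bounds C)).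

Definition tangent (R : realType) (n : nat) (C D : cap R n) : Prop :=
  exists x, boundary C `&` boundary D = [set x].

Definition spherical_descartes (R : realType) (n : nat)
    (C : 'I_n.+2 -> cap R n) : Prop :=
  (forall j k, j != k -> tangent (C j) (C k)) /\
  (trivIset setT (fun j => cap_interior (C j)) \/
   trivIset setT (fun j => cap_interior (complementary (C j)))).

Definition cot (R : realType) (a : R) : R := cos a / sin a.

(* Entry 0 is the curvature cot a; entry i.+1 is y_i / sin a. *)
Definition wplus (R : realType) (n : nat) (C : cap R n) : 'rV[R]_n.+2 :=
  row_mx (cot (angrad C))%:M ((sin (angrad C))^-1 *: center C)
    : 'rV[R]_(1 + n.+1).

Definition Wplus (R : realType) (n : nat) (C : 'I_n.+2 -> cap R n) :
    'M[R]_n.+2 :=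
  \matrix_(j < n.+2) wplus (C j).

Definition Qmx (R : realType) (n : nat) : 'M[R]_n.+2 :=
  1%:M - n%:R^-1 *: ((const_mx 1 : 'cV[R]_n.+2) *m (const_mx 1)^T).

(* diag(-2, 2, ..., 2) *)
Definition Dmx (R : realType) (n : nat) : 'M[R]_n.+2 :=
  diag_mx (\row_(i < n.+2) (if i == 0 then -2 else 2)).

(* Main.v *)
(* Give R^(n+2) the Lorentz form <(k,v),(l,u)> = v.u - k l.  The coordinates
   w(C) satisfy <w(C),w(C)> = 1, and a point x of S^n lies on the boundary
   (resp. in the interior) of C iff <(1,x),w(C)> is 0 (resp. > 0).  Since
   Q_n is twice the inverse of G = 2 I - 1 1^T, the matrix equation says that
   the rows of W have Gram matrix G, i.e. <w_j,w_k> = -1 for j <> k.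
   Tangency gives <w_j,w_k>^2 = 1, and the value 1 would put the center of the
   smaller cap in both interiors.  Conversely, if <w_j,w_k> = -1 then w_j + w_k
   is a null vector; normalising its first entry to 1 gives the tangency point,
   and the sign of that entry tells whether the interiors or the complementary
   interiors are disjoint.  Since <w_j + w_k, w_j + w_l> = -2 < 0, all these
   null vectors have the same time orientation. *)
Require Import Defs.
From mathcomp Require Import all_boot all_order all_algebra.
From mathcomp Require Import classical_sets reals trigo.
From mathcomp Require Import ring lra.
Set Implicit Arguments.
Unset Strict Implicit.
Unset Printing Implicit Defensive.
Import Order.TTheory GRing.Theory Num.Theory.
Local Open Scope ring_scope.

(** * Bilinearity and definiteness of the Euclidean dot product *)

Section DotProduct.
Context {R : realType} {m : nat}.
Implicit Types (x y z : 'rV[R]_m) (a : R).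

Lemma dotpC x y : dotp x y = dotp y x.
Proof. by apply: eq_bigr => i _; rewrite mulrC. Qed.

Lemma dotpDl x y z : dotp (x + y) z = dotp x z + dotp y z.
Proof. by rewrite -big_split; apply: eq_bigr => i _; rewrite mxE mulrDl. Qed.

Lemma dotpZl a x y : dotp (a *: x) y = a * dotp x y.
Proof. by rewrite mulr_sumr; apply: eq_bigr => i _; rewrite mxE mulrA. Qed.

Lemma dotpNl x y : dotp (- x) y = - dotp x y.
Proof. by rewrite -scaleN1r dotpZl mulN1r. Qed.

Lemma dotpDr x y z : dotp z (x + y) = dotp z x + dotp z y.
Proof. by rewrite !(dotpC z) dotpDl. Qed.

Lemma dotpZr a x y : dotp x (a *: y) = a * dotp x y.
Proof. by rewrite !(dotpC x) dotpZl. Qed.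

Lemma dotpNr x y : dotp x (- y) = - dotp x y.
Proof. by rewrite !(dotpC x) dotpNl. Qed.

Lemma dotp_ge0 x : 0 <= dotp x x.
Proof. by apply: sumr_ge0 => i _; rewrite -expr2 sqr_ge0. Qed.

Lemma dotp_eq0 x : dotp x x = 0 -> x = 0.
Proof.
move=> /eqP; rewrite psumr_eq0 => [/allP x0|i _]; last by rewrite -expr2 sqr_ge0.
apply/rowP => i; rewrite mxE; apply/eqP.
by have := x0 i (mem_index_enum _); rewrite mulf_eq0 orbb.
Qed.

Definition dotpE := (dotpDl, dotpDr, dotpNl, dotpNr, dotpZl, dotpZr).

End DotProduct.

Lemma usphereE (R : realType) (n : nat) (x : 'rV[R]_n.+1) :
  usphere x <-> dotp x x = 1.
Proof.
by rewrite /usphere /dotp /=; under eq_bigr do rewrite expr2.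
Qed.

(** * Unit vectors and null vectors *)

Section UnitVectors.
Context {R : realType} {m : nat}.
Implicit Types (x y z p q : 'rV[R]_m) (a b : R).

Lemma dotp_unit_bounds x y :
  dotp x x = 1 -> dotp y y = 1 -> -1 <= dotp x y <= 1.
Proof.
move=> xx yy; have := dotp_ge0 (x + y); have := dotp_ge0 (x - y).
by rewrite !dotpE xx yy (dotpC y x); lra.
Qed.

(* If [y], [z] are independent, reflecting [x] through their span gives another
   point with the same products, so [x] lies in the span and the Gram
   determinant of [x], [y], [z] vanishes. *)
Lemma unique_point_gram y z a b x :
    dotp y y = 1 -> dotp z z = 1 ->
    dotp x x = 1 -> dotp x y = a -> dotp x z = b ->
    (forall x', dotp x' x' = 1 -> dotp x' y = a -> dotp x' z = b -> x' = x) ->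
  (dotp y z - a * b) ^+ 2 = (1 - a ^+ 2) * (1 - b ^+ 2).
Proof.
move=> yy zz xx xy xz uniq; set t := dotp y z.
have zy : dotp z y = t by rewrite dotpC.
have yx : dotp y x = a by rewrite dotpC.
have zx : dotp z x = b by rewrite dotpC.
(* In the degenerate case [y = t *: z], so [a = t * b] and both sides are [(1 - b ^+ 2) ^+ 2]. *)
have [t1|t1] := eqVneq (1 - t ^+ 2) 0.
  have /dotp_eq0 yz : dotp (y - t *: z) (y - t *: z) = 0.
    by rewrite !dotpE yy zz zy -/t -[RHS]t1; ring.
  have : dotp x (y - t *: z) = 0.
    by rewrite yz -(scale0r (0 : 'rV[R]_m)) dotpZr mul0r.
  rewrite !dotpE xy xz => abt; have -> : a = t * b by lra.
  have t2 : t ^+ 2 = 1 by lra.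
  have -> : t - t * b * b = t * (1 - b ^+ 2) by ring.
  by rewrite !exprMn t2; ring.
(* Coefficients of the orthogonal projection of [x] to the span of [y] and [z], by Cramer's rule. *)
pose c := (a - t * b) / (1 - t ^+ 2); pose d := (b - t * a) / (1 - t ^+ 2).
have ca : c + t * d = a by rewrite /c /d; field.
have db : t * c + d = b by rewrite /c /d; field.
have xE : x = c *: y + d *: z.
  have e : 2 *: (c *: y + d *: z) - x = x.
    apply: uniq; rewrite !dotpE ?(xx, xy, xz, yx, zx, yy, zz, zy) -/t.
    - by rewrite -ca -db; ring.
    - by rewrite -ca; ring.
    - by rewrite -db; ring.
  apply: (@scalerI _ _ (2 : R)); first by rewrite pnatr_eq0.
  by rewrite [LHS]scaler_nat mulr2n -{1}e subrK.
have : dotp x x = c * a + d * b by rewrite {2}xE !dotpE xy xz.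
rewrite xx => /(congr1 (fun u => u * (1 - t ^+ 2))).
have -> : (c * a + d * b) * (1 - t ^+ 2) = (a - t * b) * a + (b - t * a) * b.
  by rewrite /c /d; field.
by move=> e; rewrite -[LHS]addr0 -(subrr (1 * (1 - t ^+ 2))) {2}e; ring.
Qed.

(* [(a, p)] and [(b, q)] are null vectors of the Lorentz form. *)
Lemma null_future a p b q :
  dotp p p = a ^+ 2 -> dotp q q = b ^+ 2 -> dotp p q < a * b -> 0 < a * b.
Proof.
move=> pp qq pq; rewrite lt_neqAle; apply/andP; split.
  apply: contraTneq pq => /esym ab0; rewrite ab0 -leNgt le_eqVlt; apply/orP; left.
  move/eqP: ab0; rewrite mulf_eq0 => /orP[] /eqP e0.
    have -> : p = 0 by apply: dotp_eq0; rewrite pp e0 expr0n.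
    by rewrite -(scale0r (0 : 'rV[R]_m)) dotpZl mul0r.
  have -> : q = 0 by apply: dotp_eq0; rewrite qq e0 expr0n.
  by rewrite -(scale0r (0 : 'rV[R]_m)) dotpZr mul0r.
(* The cross terms leave [2ab(ab - p.q)], whose last factor is positive by hypothesis. *)
have := dotp_ge0 (b *: p - a *: q); rewrite !dotpE pp qq (dotpC q p).
rewrite [X in 0 <= X -> _](_ : _ = 2 * ((a * b) * (a * b - dotp p q))); last first.
  by ring.
by rewrite pmulr_rge0 // pmulr_lge0 // subr_gt0.
Qed.

(** The square of [p - a *: x] is [2a(a - x.p)]. In Lorentz terms, the future null vectors [(1,x)]
    and [(a,p)] have nonpositive product. *)
Lemma null_dotp_le a p x : 0 < a ->
  dotp p p = a ^+ 2 -> dotp x x = 1 -> dotp x p <= a.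
Proof.
move=> a0 pp xx; have := dotp_ge0 (p - a *: x).
rewrite !dotpE pp xx (dotpC p x).
rewrite [X in 0 <= X -> _](_ : _ = 2 * (a * (a - dotp x p))); last by ring.
by rewrite pmulr_rge0 // pmulr_rge0 // subr_ge0.
Qed.

End UnitVectors.

(** * Caps as Lorentz vectors: incidence, tangency and disjointness *)

Section Caps.
Context {R : realType} {n : nat}.
Implicit Types (C D : cap R n) (x : 'rV[R]_n.+1).

(** The space part of [w(C)], whose time part is [cot (angrad C)]. *)
Definition spole C : 'rV[R]_n.+1 := (sin (angrad C))^-1 *: center C.

(** This is the Lorentz product [<w(C),w(D)>]. *)
Definition inversive_product C D : R :=
  dotp (spole C) (spole D) - cot (angrad C) * cot (angrad D).

Lemma sin_angrad_gt0 C : 0 < sin (angrad C).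
Proof. exact/sin_gt0_pi/angrad_bounds. Qed.

Lemma angrad_itv C : angrad C \in `[0, pi].
Proof. by rewrite in_itv /=; case/andP: (angrad_bounds C) => /ltW -> /ltW ->. Qed.

Lemma center_unit C : dotp (center C) (center C) = 1.
Proof. exact/usphereE/center_usphere. Qed.

Lemma dotp_spole C x : dotp x (spole C) = dotp x (center C) / sin (angrad C).
Proof. by rewrite dotpZr mulrC. Qed.

Lemma dotp_spole_self C : dotp (spole C) (spole C) = 1 + cot (angrad C) ^+ 2.
Proof.
have s0 := lt0r_neq0 (sin_angrad_gt0 C).
rewrite dotpZl dotp_spole center_unit /cot expr_div_n cos2sin2.
by field.
Qed.

Lemma inversive_product_self C : inversive_product C C = 1.
Proof. by rewrite /inversive_product dotp_spole_self expr2 addrK. Qed.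

(** Cosine is injective on [[0, pi]], so the condition on the angle becomes linear in [x]. *)
Lemma boundaryE C x :
  boundary C x <-> dotp x x = 1 /\ dotp x (spole C) = cot (angrad C).
Proof.
have s0 := lt0r_neq0 (sin_angrad_gt0 C).
rewrite /boundary /angdist /= usphereE dotp_spole /cot.
split=> -[xx h]; split=> //.
  by rewrite -h acosK // in_itv /= dotp_unit_bounds ?center_unit.
by rewrite (divIf s0 h) cosK ?angrad_itv.
Qed.

Lemma cap_interiorE C x :
  cap_interior C x <-> dotp x x = 1 /\ cot (angrad C) < dotp x (spole C).
Proof.
have s0 := sin_angrad_gt0 C.
rewrite /cap_interior /angdist /= usphereE dotp_spole /cot.
have H (xx : dotp x x = 1) : (acos (dotp x (center C)) < angrad C) =
    (cos (angrad C) / sin (angrad C) < dotp x (center C) / sin (angrad C)).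
  have xC : -1 <= dotp x (center C) <= 1 by rewrite dotp_unit_bounds ?center_unit.
  rewrite ltr_pM2r ?invr_gt0 // -[in RHS](acosK xC) ltr_cos ?angrad_itv //.
  by rewrite in_itv /= acos_ge0 ?acos_lepi.
by split=> -[xx h]; split=> //; move: h; rewrite H.
Qed.

Lemma spole_complementary C : spole (complementary C) = - spole C.
Proof.
by rewrite /spole /= sinB sinpi cospi mul0r mulN1r sub0r opprK scalerN.
Qed.

Lemma cot_complementary C :
  cot (angrad (complementary C)) = - cot (angrad C).
Proof.
by rewrite /cot /= sinB cosB sinpi cospi !mul0r !mulN1r sub0r opprK addr0 mulNr.
Qed.

Lemma inversive_product_complementary C D :
  inversive_product (complementary C) (complementary D) = inversive_product C D.
Proof.
rewrite /inversive_product !spole_complementary !cot_complementary.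
by rewrite !dotpE opprK mulrNN.
Qed.

Lemma inversive_productC C D : inversive_product C D = inversive_product D C.
Proof. by rewrite /inversive_product dotpC mulrC. Qed.

Lemma inversive_productE C D : inversive_product C D =
  (dotp (center C) (center D) - cos (angrad C) * cos (angrad D)) /
    (sin (angrad C) * sin (angrad D)).
Proof.
have sC := lt0r_neq0 (sin_angrad_gt0 C).
have sD := lt0r_neq0 (sin_angrad_gt0 D).
by rewrite /inversive_product dotpZl dotp_spole /cot; field; rewrite sC sD.
Qed.

(** The tangency point is the only unit vector with the prescribed products with both centers, so
    [unique_point_gram] applies; its right-hand side is the squared product of the sines. *)
Lemma tangent_inversive_product C D :
  tangent C D -> inversive_product C D ^+ 2 = 1.
Proof.
case=> x E.
have [/boundaryE[xx xC] /boundaryE[_ xD]] : (boundary C `&` boundary D)%classic x.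
  by rewrite E.
have sC := lt0r_neq0 (sin_angrad_gt0 C).
have sD := lt0r_neq0 (sin_angrad_gt0 D).
rewrite inversive_productE expr_div_n.
rewrite (@unique_point_gram _ _ _ _ _ _ x) ?center_unit //.
- by rewrite -!sin2cos2 -exprMn divff // expf_neq0 // mulf_neq0.
- by move: xC; rewrite dotp_spole => /(divIf sC).
- by move: xD; rewrite dotp_spole => /(divIf sD).
- move=> x' x'x' x'C x'D.
  have : (boundary C `&` boundary D)%classic x'.
    by split; apply/boundaryE; split=> //; rewrite dotp_spole ?x'C ?x'D.
  by rewrite E.
Qed.

(** By the cosine subtraction formula the centers are at distance [angrad D - angrad C], which is
    less than [angrad D]. *)
Lemma center_in_interior C D : inversive_product C D = 1 ->
  angrad C <= angrad D -> cap_interior D (center C).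
Proof.
have sC := lt0r_neq0 (sin_angrad_gt0 C).
have sD := sin_angrad_gt0 D.
rewrite inversive_productE => e CD.
apply/cap_interiorE; split; first exact: center_unit.
rewrite dotp_spole /cot ltr_pM2r ?invr_gt0 //.
have -> : dotp (center C) (center D) = cos (angrad D - angrad C).
  move/(congr1 (fun u => u * (sin (angrad C) * sin (angrad D)))): e.
  rewrite divfK ?mulf_neq0 ?(lt0r_neq0 sD) // mul1r cosB => e.
  by rewrite [X in X + _]mulrC [X in _ + X]mulrC -e; ring.
case/andP: (angrad_bounds C) (angrad_bounds D) => C0 Cpi /andP[D0 Dpi].
by rewrite ltr_cos ?angrad_itv // ?in_itv /=; lra.
Qed.

Lemma center_in_own_interior C : cap_interior C (center C).
Proof. by apply: center_in_interior => //; exact: inversive_product_self. Qed.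

Lemma disjoint_tangent_inversive_product C D : tangent C D ->
    ~ (cap_interior C `&` cap_interior D !=set0)%classic ->
  inversive_product C D = -1.
Proof.
move=> /tangent_inversive_product /eqP.
rewrite sqrf_eq1 => /orP[] /eqP // e [].
case: (lerP (angrad C) (angrad D)) => [|/ltW] CD.
  exists (center C); split; first exact: center_in_own_interior.
  exact: center_in_interior.
exists (center D); split; last exact: center_in_own_interior.
by apply: center_in_interior; rewrite // inversive_productC.
Qed.

Lemma boundary_complementary C : boundary (complementary C) = boundary C.
Proof.
apply/seteqP; split=> x /boundaryE[xx xC]; apply/boundaryE; split=> //.
  by apply: oppr_inj; rewrite -dotpNr -spole_complementary -cot_complementary.
by rewrite spole_complementary cot_complementary dotpNr xC.
Qed.

Lemma spherical_descartes_inversive_product (C : 'I_n.+2 -> cap R n) j k :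
  spherical_descartes C -> j != k -> inversive_product (C j) (C k) = -1.
Proof.
move=> [tan disj] jk; have t := tan _ _ jk.
case: disj => disj.
  apply: disjoint_tangent_inversive_product => //.
  by move=> /(disj _ _ I I) /eqP; apply/negP.
(* In case (ii), complementation negates both Lorentz vectors, which preserves their product and the
   boundaries. *)
rewrite -inversive_product_complementary.
apply: disjoint_tangent_inversive_product.
  by case: t => x e; exists x; rewrite !boundary_complementary.
by move=> /(disj _ _ I I) /eqP; apply/negP.
Qed.

(** The Lorentz square of [w(C) + w(D)] is [1 + 1 - 2 = 0]. *)
Lemma dotp_spoleD_self C D : inversive_product C D = -1 ->
  dotp (spole C + spole D) (spole C + spole D) =
    (cot (angrad C) + cot (angrad D)) ^+ 2.
Proof.
rewrite /inversive_product => e.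
by rewrite !(dotpDl, dotpDr) !dotp_spole_self (dotpC (spole D)); lra.
Qed.

Lemma inversive_product_tangent C D : inversive_product C D = -1 ->
  cot (angrad C) + cot (angrad D) != 0 -> tangent C D.
Proof.
move=> e; move: e (dotp_spoleD_self e) (boundaryE C) (boundaryE D).
move: (dotp_spole_self C) (dotp_spole_self D); rewrite /inversive_product.
move: (spole C) (spole D) (cot (angrad C)) (cot (angrad D)) => v u k l.
move=> vv uu e pp bC bD kl0.
exists ((k + l)^-1 *: (v + u)); apply/seteqP; split=> x /=.
  case=> /bC[xx xv] /bD[_ xu].
  (* Uniqueness: [x] and the normalised null vector are unit vectors whose product is 1, so their
     difference has square zero. *)
  apply/eqP; rewrite -subr_eq0; apply/eqP/dotp_eq0.
  rewrite (dotpDl x) !(dotpDr x) !(dotpNl, dotpNr, dotpZl, dotpZr) pp.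
  rewrite (dotpC (v + u) x) dotpDr xx xv xu.
  by field.
move=> ->; split; [apply/bC|apply/bD]; split.
- by rewrite dotpZl dotpZr pp; field.
- rewrite dotpZl dotpDl vv (dotpC u v).
  have -> : dotp v u = k * l - 1 by lra.
  by field.
- by rewrite dotpZl dotpZr pp; field.
- rewrite dotpZl dotpDl uu.
  have -> : dotp v u = k * l - 1 by lra.
  by field.
Qed.

(** A common interior point [x] would make the product of [(1,x)] with the future null vector
    [w(C) + w(D)] positive. *)
Lemma inversive_product_disjoint C D : inversive_product C D = -1 ->
  0 < cot (angrad C) + cot (angrad D) ->
  ~ (cap_interior C `&` cap_interior D !=set0)%classic.
Proof.
move=> /dotp_spoleD_self pp kl0 [x [/cap_interiorE[xx xC] /cap_interiorE[_ xD]]].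
by have := null_dotp_le kl0 pp xx; rewrite dotpDr; lra.
Qed.

End Caps.

(** As [1 + cot^2 = 1 / sin^2], the number [r] must be the inverse sine, which forces the angle
    [acos (c / r)] and the center [v / r]. *)
Lemma cap_of_coordinates {R : realType} {n : nat} (c : R) (v : 'rV[R]_n.+1) :
  dotp v v = 1 + c ^+ 2 ->
  exists C : cap R n, spole C = v /\ cot (angrad C) = c.
Proof.
move=> vv; set r := Num.sqrt (1 + c ^+ 2).
have r2 : r ^+ 2 = 1 + c ^+ 2 by rewrite sqr_sqrtr // addr_ge0 // sqr_ge0.
have r0 : 0 < r by rewrite sqrtr_gt0 ltr_pwDl // sqr_ge0.
have rn0 := lt0r_neq0 r0.
have cr : -1 < c / r < 1.
  rewrite -ltr_norml normrM normfV (gtr0_norm r0) ltr_pdivrMr // mul1r.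
  rewrite -(ltr_pXn2r (n := 2)) // ?nnegrE // ?(ltW r0) // r2.
  by rewrite real_normK ?num_real // ltrDr.
have [cr1 cr2] := andP cr.
have cr' : -1 <= c / r <= 1 by rewrite (ltW cr1) (ltW cr2).
have cosa : cos (acos (c / r)) = c / r by rewrite acosK.
have sina : sin (acos (c / r)) = r^-1.
  rewrite sin_acos // [X in Num.sqrt X](_ : _ = r^-1 ^+ 2).
    by rewrite sqrtr_sqr ger0_norm // invr_ge0 ltW.
  apply: (mulIf (expf_neq0 2 rn0)).
  by rewrite mulrBl mul1r -!exprMn divfK // mulVf // r2 addrK expr1n.
have ab : 0 < acos (c / r) < pi.
  by rewrite acos_gt0 ?acos_ltpi ?cr1 ?cr2 ?(ltW cr1) ?(ltW cr2).
have cu : usphere (r^-1 *: v) by apply/usphereE; rewrite !dotpE vv -r2; field.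
exists (Cap cu ab); rewrite /spole /cot /= sina cosa invrK scalerA divff //.
by rewrite scale1r divfK.
Qed.

(** * From the matrix equation to Gram matrices *)

Section Matrices.
Context {R : realType}.

Lemma mulmx_scalarC {m : nat} (A B : 'M[R]_m) (c : R) :
  c != 0 -> A *m B = c%:M -> B *m A = c%:M.
Proof.
move=> c0 e; have /mulmx1C : (c^-1 *: A) *m B = 1%:M.
  by rewrite -scalemxAl e -mul_scalar_mx -scalar_mxM mulVf.
rewrite -scalemxAr => /(congr1 (fun M => c *: M)).
by rewrite scalerA divff // scale1r scalemx1.
Qed.

Definition tangency_gram (m : nat) : 'M[R]_m := 2%:M - const_mx 1.

Lemma tangency_gramE m j k :
  tangency_gram m j k = if j == k then 1 else -1.
Proof.
by rewrite !mxE; case: eqP => _ /=; rewrite ?mulr1n ?mulr0n; ring.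
Qed.

(** With [J] the all-ones matrix, [J^2 = (n+2) J], so the coefficient of [J] is
    [-1 - 2/n + (n+2)/n = 0]. *)
Lemma Qmx_tangency_gram n : (0 < n)%N -> Qmx R n *m tangency_gram n.+2 = 2%:M.
Proof.
move=> n0; have nz : n%:R != 0 :> R by rewrite pnatr_eq0 -lt0n.
rewrite /Qmx /tangency_gram.
have -> : (const_mx 1 : 'cV[R]_n.+2) *m (const_mx 1)^T = const_mx 1 :> 'M[R]_n.+2.
  by apply/matrixP => i j; rewrite !mxE big_ord1 !mxE mulr1.
have JJ : (const_mx 1 : 'M[R]_n.+2) *m const_mx 1 = n.+2%:R *: const_mx 1 :> 'M[R]_n.+2.
  apply/matrixP => i j; rewrite !mxE.
  by under eq_bigr do rewrite !mxE mulr1; rewrite sumr_const card_ord mulr1.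
rewrite mulmxBr mulmxBl mul1mx mul_mx_scalar mulmxBl mul1mx -scalemxAl JJ.
apply/matrixP => i j; rewrite !mxE -addn2 natrD.
by case: eqVneq => _ /=; rewrite ?mulr1n ?mulr0n; field.
Qed.

Lemma Dmx_sqr n : Dmx R n *m Dmx R n = 4%:M.
Proof.
rewrite mulmx_diag -diag_const_mx; congr diag_mx; apply/rowP => i; rewrite !mxE.
by case: ifP => _; ring.
Qed.

(** Write [D], [Q], [G] for the three constant matrices. Since [D^2 = 4], the first equation gives
    [D W^T Q W = 4]; cyclically [W D W^T Q = 4], and [Q G = 2] yields the second. The converse
    retraces these steps. *)
Lemma Dmx_gram n (W : 'M[R]_n.+2) : (0 < n)%N ->
  (W^T *m Qmx R n *m W = Dmx R n) <->
  (W *m Dmx R n *m W^T = 2 *: tangency_gram n.+2).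
Proof.
move=> n0; have four : 4 != 0 :> R by rewrite pnatr_eq0.
have two : 2 != 0 :> R by rewrite pnatr_eq0.
have QG := @Qmx_tangency_gram n n0.
have GQ := mulmx_scalarC two QG.
split=> e.
  have : Dmx R n *m W^T *m Qmx R n *m W = 4%:M.
    by rewrite -!mulmxA (mulmxA W^T) e Dmx_sqr.
  move=> /(mulmx_scalarC four) /(congr1 (mulmx^~ (tangency_gram n.+2))).
  rewrite !mulmxA -(mulmxA _ (Qmx R n)) QG mul_mx_scalar mul_scalar_mx.
  move=> h; apply: (scalerI two); rewrite h scalerA; congr (_ *: _); ring.
have : W *m (Dmx R n *m W^T *m Qmx R n) = 4%:M.
  rewrite !mulmxA e -scalemxAl GQ -mul_scalar_mx -scalar_mxM; congr (_%:M); ring.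
move=> /(mulmx_scalarC four) /(congr1 (mulmx (Dmx R n))).
rewrite !mulmxA Dmx_sqr mul_scalar_mx -!scalemxAl mul_mx_scalar.
exact: scalerI.
Qed.

(** [Dmx] is twice the matrix of the Lorentz form. *)
Lemma lorentz_gramE n (W : 'M[R]_n.+2) j k :
  (W *m Dmx R n *m W^T) j k =
  2 * (\sum_i W j (rshift 1 i) * W k (rshift 1 i) - W j 0 * W k 0).
Proof.
rewrite /Dmx mul_mx_diag mxE (@big_split_ord _ _ _ 1 n.+1) /= big_ord1 !mxE /=.
have -> : lshift n.+1 (0 : 'I_1) = 0 :> 'I_n.+2 by apply/val_inj.
rewrite mulrBr addrC mulr_sumr; congr (_ + _); last by ring.
by apply: eq_bigr => i _; rewrite !mxE /=; ring.
Qed.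

Lemma Wplus0 n (C : 'I_n.+2 -> cap R n) j : Wplus C j 0 = cot (angrad (C j)).
Proof.
have -> : 0 = lshift n.+1 (0 : 'I_1) :> 'I_n.+2 by apply/val_inj.
by rewrite mxE /wplus (@row_mxEl _ 1 1 n.+1) mxE mulr1n.
Qed.

Lemma Wplus_rshift n (C : 'I_n.+2 -> cap R n) j i :
  Wplus C j (rshift 1 i) = spole (C j) 0 i.
Proof. by rewrite mxE /wplus (@row_mxEr _ 1 1 n.+1). Qed.

Lemma Wplus_gramE n (C : 'I_n.+2 -> cap R n) j k :
  (Wplus C *m Dmx R n *m (Wplus C)^T) j k =
  2 * inversive_product (C j) (C k).
Proof.
rewrite lorentz_gramE !Wplus0; congr (_ * (_ - _)).
by apply: eq_bigr => i _; rewrite !Wplus_rshift.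
Qed.

Lemma Wplus_tangency_gram n (C : 'I_n.+2 -> cap R n) :
  Wplus C *m Dmx R n *m (Wplus C)^T = 2 *: tangency_gram n.+2 <->
  (forall j k, j != k -> inversive_product (C j) (C k) = -1).
Proof.
have two : 2 != 0 :> R by rewrite pnatr_eq0.
split=> [e j k jk|e].
  apply: (mulfI two); rewrite -Wplus_gramE e mxE tangency_gramE.
  by rewrite (negbTE jk).
apply/matrixP => j k; rewrite Wplus_gramE mxE tangency_gramE.
by case: eqVneq => [->|/e ->//]; rewrite inversive_product_self.
Qed.

(** A diagonal entry 2 says that the row has Lorentz square 1, as [cap_of_coordinates] requires. *)
Lemma Wplus_surj n (W : 'M[R]_n.+2) :
  (forall j, (W *m Dmx R n *m W^T) j j = 2) ->
  exists C : 'I_n.+2 -> cap R n, W = Wplus C.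
Proof.
move=> e.
have /fin_all_exists[C WC] j : exists C : cap R n,
    spole C = \row_i W j (rshift 1 i) /\ cot (angrad C) = W j 0.
  apply: cap_of_coordinates; move: (e j); rewrite lorentz_gramE.
  have -> : dotp (\row_i W j (rshift 1 i)) (\row_i W j (rshift 1 i)) =
      \sum_i W j (rshift 1 i) * W j (rshift 1 i).
    by apply: eq_bigr => i _; rewrite !mxE.
  by lra.
exists C; apply/matrixP => j i; have [WC1 WC2] := WC j.
case: (@split_ordP 1 n.+1 i) => i' ->.
  have -> : lshift n.+1 i' = 0 :> 'I_n.+2 by apply/val_inj; rewrite /= ord1.
  by rewrite Wplus0.
by rewrite Wplus_rshift WC1 mxE.
Qed.

End Matrices.

(** Applied to the cotangents, this gives all the null vectors [w_j + w_k] one time orientation. *)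
Lemma same_sign_sums {R : realDomainType} {T : finType} (f : T -> R) :
    (2 < #|T|)%N ->
    (forall j k l, uniq [:: j; k; l] -> 0 < (f j + f k) * (f j + f l)) ->
  (forall j k, j != k -> 0 < f j + f k) \/
  (forall j k, j != k -> f j + f k < 0).
Proof.
move=> T3 pos.
(* When [k = l], a third index [i] is needed to see that [f j + f k] is nonzero. *)
have posW j k l : j != k -> j != l -> 0 < (f j + f k) * (f j + f l).
  move=> jk jl; have [<-|kl] := eqVneq k l; last first.
    by apply: pos; rewrite /= !inE negb_or jk jl kl.
  have [i] : exists i, i \notin [:: j; k].
    apply/existsP; rewrite -negb_forall; apply: contraL T3 => /forallP jkT.
    rewrite -leqNgt (leq_trans _ (card_size [:: j; k])) //.
    by apply/subset_leq_card/fintype.subsetP => i _; apply: jkT.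
  rewrite !inE negb_or => /andP[ij ik].
  have := pos j k i; rewrite /= !inE negb_or jk.
  rewrite [j == i]eq_sym [k == i]eq_sym ij ik => /(_ isT) h.
  rewrite -expr2 lt_neqAle sqr_ge0 andbT eq_sym sqrf_eq0.
  by apply: contraTneq h => ->; rewrite mul0r ltxx.
(* The pairs [{j,k}] and [{l,m}] are linked through [{j,l}], changing one index at a time. *)
have posE j k l m : j != k -> l != m -> 0 < f j + f k -> 0 < f l + f m.
  have step i i' i'' : i != i' -> i != i'' -> 0 < f i + f i' -> 0 < f i + f i''.
    by move=> ii' ii'' p; rewrite -(pmulr_rgt0 _ p) posW.
  move=> jk; have [<- jm|jl lm] := eqVneq j l; first exact: step.
  by move=> /(step _ _ _ jk jl); rewrite addrC; apply: step; rewrite // eq_sym.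
have [/existsP[j /existsP[k /andP[jk p]]]|none] :=
  boolP [exists j, exists k, (j != k) && (0 < f j + f k)].
  by left => l m lm; apply: posE p.
right=> j k jk; rewrite ltNge le_eqVlt negb_or; apply/andP; split.
  by have := posW _ _ _ jk jk; apply: contraTneq => <-; rewrite mul0r ltxx.
apply: contra none => p.
by apply/existsP; exists j; apply/existsP; exists k; rewrite jk.
Qed.

Theorem theorem4p2 (R : realType) (n : nat) (hn : (2 <= n)%N) :
  (forall C : 'I_n.+2 -> cap R n,
     spherical_descartes C ->
     (Wplus C)^T *m Qmx R n *m Wplus C = Dmx R n) /\
  (forall W : 'M[R]_n.+2,
     W^T *m Qmx R n *m W = Dmx R n ->
     exists C : 'I_n.+2 -> cap R n, spherical_descartes C /\ W = Wplus C).
Proof.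
have n0 : (0 < n)%N by apply: ltn_trans hn.
split=> [C CD|W /(Dmx_gram W n0) WG].
  apply/(Dmx_gram _ n0)/Wplus_tangency_gram => j k.
  exact: spherical_descartes_inversive_product.
have [j|C WC] := @Wplus_surj _ _ W.
  by rewrite WG mxE tangency_gramE eqxx mulr1.
exists C; split=> //; subst W.
move/Wplus_tangency_gram: WG => CC.
have [|j k l|pos|neg] := @same_sign_sums _ _ (fun j => cot (angrad (C j))).
- by rewrite card_ord ltnS ltnW.
- rewrite /= !inE negb_or andbT => /andP[/andP[jk jl] kl].
  have pjk := dotp_spoleD_self (CC _ _ jk).
  have pjl := dotp_spoleD_self (CC _ _ jl).
  apply: null_future pjk pjl _.
  have := dotp_spole_self (C j); rewrite !(dotpDl, dotpDr).
  have := CC _ _ jk; have := CC _ _ jl; have := CC _ _ kl.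
  by rewrite /inversive_product (dotpC (spole (C k)) (spole (C j))); lra.
- split=> [j k jk|].
    by apply: inversive_product_tangent (CC _ _ jk) (lt0r_neq0 (pos _ _ jk)).
  left=> j k _ _; apply: contraPeq => jk.
  exact: inversive_product_disjoint (CC _ _ jk) (pos _ _ jk).
- split=> [j k jk|].
    by apply: inversive_product_tangent (CC _ _ jk) (ltr0_neq0 (neg _ _ jk)).
  (* Complementation changes the sign of every cotangent sum, so the disjointness criterion applies
     to the complementary caps. *)
  right=> j k _ _; apply: contraPeq => jk.
  apply: inversive_product_disjoint.
    by rewrite inversive_product_complementary CC.
  by rewrite !cot_complementary -opprD oppr_gt0 neg.
Qed.
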